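(* Let $n\in\mathbb{N}$ and let $q=p^r$ be a power of an odd prime $p$ ($r\in\mathbb{N}$). Suppose the following hold. (1) $q\equiv 1 \pmod n$ and $\gcd(n,(q-1)/n)=1$. (2) The group $\mathrm{GL}_2(\mathbb{F}_q)$ is realizable as the Galois group over $\mathbb{Q}$ of extensions $E_1,E_2$ contained in $\bar{\mathbb{Q}}$ such that $E_1\cap E_2=K$ is a degree $n$ abelian extension of $\mathbb{Q}$. Let $H$ be the unique index-$n$ subgroup of $\mathrm{GL}_2(\mathbb{F}_q)$ such that the quotient is abelian. Then, for some compositum-type law (defined in the context) attached to $\Gamma=\mathrm{GL}_2(\mathbb{F}_q)$ and $N=H$, the group $(H\times H)\rtimes \mathrm{GL}_2(\mathbb{F}_q)/H$ is realizable as a Galois group over $\mathbb{Q}$.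
   Context: A finite group is realizable as a Galois group over $\mathbb{Q}$ if it is isomorphic to $\mathrm{Gal}(E/\mathbb{Q})$ for some finite Galois extension $E/\mathbb{Q}$. When $n\mid q-1$, $\mathrm{GL}_2(\mathbb{F}_q)$ has a unique normal subgroup of index $n$ with abelian quotient, namely $\{x\in \mathrm{GL}_2(\mathbb{F}_q)\mid \det(x)\text{ is an }n\text{-th power in }\mathbb{F}_q^\times\}$. Compositum-type law. Let $\Gamma$ be a finite group and $N$ a normal subgroup of index $n$. Suppose given an automorphism $\theta$ of $\Gamma/N$ and two sets $\{x_1,\dots,x_n\}$, $\{y_1,\dots,y_n\}$ of representatives of the $N$-cosets in $\Gamma$, each closed under multiplication, with $x_iN=\theta(y_iN)$ for all $i$. The associated compositum-type law on the set $(N\times N)\times \Gamma/N$ is $$((h_1,h_2),x_iN)\cdot((k_1,k_2),x_jN)=\big((x_j^{-1}h_1x_jk_1,\; y_j^{-1}h_2y_jk_2),\; x_ix_jN\big),$$ and the resulting semidirect product group is denoted $(N\times N)\rtimes \Gamma/N$. *)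

(* Defs.v *)
From HB Require Import structures.
From mathcomp Require Import all_boot all_order all_fingroup all_algebra.
From mathcomp Require Import all_solvable all_field.

Set Implicit Arguments.
Unset Strict Implicit.
Unset Printing Implicit Defensive.

Import GroupScope GRing.Theory.

Definition has_galois_group (E : splittingFieldType rat)
    (gT : finGroupType) (G : {group gT}) : Prop :=
  galois 1%AS {:E}%AS /\ 'Gal({:E} / 1%AS) \isog G.

Definition realizable_over_rat (gT : finGroupType) (G : {group gT}) : Prop :=
  exists E : splittingFieldType rat, has_galois_group E G.

Definition abelian_extension (E : splittingFieldType rat) : Prop :=
  galois 1%AS {:E}%AS /\ abelian 'Gal({:E} / 1%AS).

(* Subfields of the algebraic closure algC of rat are images of embeddings;
   here the image of k is the intersection of the images of i1 and i2. *)
Definition image_is_intersection (K E1 E2 : splittingFieldType rat)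
    (k : {rmorphism K -> algC})
    (i1 : {rmorphism E1 -> algC}) (i2 : {rmorphism E2 -> algC}) : Prop :=
  forall z : algC,
    (exists c, k c = z) <-> (exists a, i1 a = z) /\ (exists b, i2 b = z).

Section CompositumLaw.

Variables (gT : finGroupType) (G N : {group gT}).

Definition coset_representatives (x : 'I_#|G : N| -> gT) : Prop :=
  (forall i, x i \in G) /\
  (forall c, c \in G / N -> exists! i, coset N (x i) = c).

Definition closed_under_mul (I : Type) (x : I -> gT) : Prop :=
  forall i j, exists k, x k = x i * x j.

(* The automorphism of G / N is a permutation of the type of all cosets of N in
   its normaliser, supported on G / N. *)
Record compositum_data := CompositumData {
  cd_normal : N <| G;
  cd_theta : {perm coset_of N};
  cd_x : 'I_#|G : N| -> gT;
  cd_y : 'I_#|G : N| -> gT;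
  cd_theta_aut : cd_theta \in Aut (G / N);
  cd_x_repr : coset_representatives cd_x;
  cd_y_repr : coset_representatives cd_y;
  cd_x_mul : closed_under_mul cd_x;
  cd_y_mul : closed_under_mul cd_y;
  cd_xy : forall i, coset N (cd_x i) = cd_theta (coset N (cd_y i))
}.

Variable D : compositum_data.

(* The index j such that c = x_j N; the default value is not used when c is in
   G / N. *)
Definition cd_index (c : coset_of N) : 'I_#|G : N| :=
  odflt (Ordinal (indexg_gt0 G N)) [pick j | coset N (cd_x D j) == c].

Definition compositum_law (u v : gT * gT * coset_of N) :
    gT * gT * coset_of N :=
  let: (h1, h2, c) := u in
  let: (k1, k2, d) := v in
  let xj := cd_x D (cd_index d) in
  let yj := cd_y D (cd_index d) in
  (xj^-1 * h1 * xj * k1, yj^-1 * h2 * yj * k2, c * d).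

Lemma cd_indexK c : c \in G / N -> coset N (cd_x D (cd_index c)) = c.
Proof.
move=> Gc; rewrite /cd_index; case: pickP => [j /eqP // | no].
have [j [Ej _]] := (cd_x_repr D).2 c Gc.
by have := no j; rewrite Ej eqxx.
Qed.

Lemma cd_index_theta c : c \in G / N ->
  cd_theta D (coset N (cd_y D (cd_index c))) = c.
Proof. by move=> Gc; rewrite -cd_xy cd_indexK. Qed.

Lemma cd_x_nN i : cd_x D i \in 'N(N).
Proof.
exact: subsetP (normal_norm (cd_normal D)) _ ((cd_x_repr D).1 i).
Qed.

Lemma cd_y_nN i : cd_y D i \in 'N(N).
Proof.
exact: subsetP (normal_norm (cd_normal D)) _ ((cd_y_repr D).1 i).
Qed.

Lemma coset_repr_inj x : coset_representatives x ->
  injective (fun i => coset N (x i)).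
Proof.
case=> Gx ex_x i j Eij.
have [k [_ uk]] := ex_x _ (mem_quotient N (Gx i)).
by rewrite -(uk i) // -(uk j).
Qed.

Lemma cd_xM c d : c \in G / N -> d \in G / N ->
  cd_x D (cd_index (c * d)) = cd_x D (cd_index c) * cd_x D (cd_index d).
Proof.
move=> Gc Gd; have [k Ek] := cd_x_mul D (cd_index c) (cd_index d).
rewrite -Ek; congr (cd_x D _); apply: (coset_repr_inj (cd_x_repr D)).
by rewrite Ek morphM ?cd_x_nN //= !cd_indexK ?groupM.
Qed.

Lemma cd_yM c d : c \in G / N -> d \in G / N ->
  cd_y D (cd_index (c * d)) = cd_y D (cd_index c) * cd_y D (cd_index d).
Proof.
move=> Gc Gd; have [k Ek] := cd_y_mul D (cd_index c) (cd_index d).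
rewrite -Ek; congr (cd_y D _); apply: (coset_repr_inj (cd_y_repr D)).
rewrite Ek morphM ?cd_y_nN //=; apply: (@perm_inj _ (cd_theta D)).
have thM : {in G / N &, {morph cd_theta D : a b / a * b}}.
  by have := cd_theta_aut D; rewrite inE => /andP[_ /morphicP].
rewrite cd_index_theta ?groupM // thM ?cd_index_theta //;
  exact/mem_quotient/(cd_y_repr D).1.
Qed.

Lemma cd_x1 : cd_x D (cd_index 1) = 1.
Proof. by apply: (mulgI (cd_x D (cd_index 1))); rewrite -cd_xM ?mulg1. Qed.

Lemma cd_y1 : cd_y D (cd_index 1) = 1.
Proof. by apply: (mulgI (cd_y D (cd_index 1))); rewrite -cd_yM ?mulg1. Qed.

Lemma cd_conj_mem (a h : gT) : a \in 'N(N) -> h \in N -> a^-1 * h * a \in N.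
Proof. by move=> Na Nh; rewrite -mulgA -conjgE memJ_norm. Qed.

Lemma cd_conjV_mem (a h : gT) : a \in 'N(N) -> h \in N -> a * h * a^-1 \in N.
Proof.
by move=> Na Nh; rewrite -{1}[a]invgK cd_conj_mem ?groupV.
Qed.

Definition compositum_carrier : {set gT * gT * coset_of N} :=
  setX (setX N N) (G / N).

Lemma compositum_law_in u v :
  u \in compositum_carrier -> v \in compositum_carrier ->
  compositum_law u v \in compositum_carrier.
Proof.
case: u v => [[h1 h2] c] [[k1 k2] d].
rewrite !inE /= => /andP[/andP[Nh1 Nh2] Gc] /andP[/andP[Nk1 Nk2] Gd].
rewrite [c * d \in _]groupM // andbT.
by apply/andP; split; rewrite groupM ?cd_conj_mem ?cd_x_nN ?cd_y_nN.
Qed.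

Definition compositum_law_inv (u : gT * gT * coset_of N) :
    gT * gT * coset_of N :=
  let: (h1, h2, c) := u in
  let xi := cd_x D (cd_index c) in
  let yi := cd_y D (cd_index c) in
  (xi * h1^-1 * xi^-1, yi * h2^-1 * yi^-1, c^-1).

Lemma compositum_one_in : (1, 1, 1) \in compositum_carrier.
Proof. by rewrite !inE /= !group1. Qed.

Lemma compositum_inv_in u :
  u \in compositum_carrier -> compositum_law_inv u \in compositum_carrier.
Proof.
case: u => [[h1 h2] c]; rewrite !inE /= => /andP[/andP[Nh1 Nh2] Gc].
by rewrite groupV Gc !cd_conjV_mem ?groupV ?cd_x_nN ?cd_y_nN.
Qed.

Lemma compositum_lawA u v w : u \in compositum_carrier ->
  v \in compositum_carrier -> w \in compositum_carrier ->
  compositum_law u (compositum_law v w) = compositum_law (compositum_law u v) w.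
Proof.
case: u v w => [[h1 h2] c] [[k1 k2] d] [[l1 l2] e].
rewrite !inE /= => /andP[_ Gc] /andP[_ Gd] /andP[_ Ge].
by rewrite cd_xM // cd_yM // !invMg !mulgA !mulgK.
Qed.

Lemma compositum_law1 u : compositum_law (1, 1, 1) u = u.
Proof. by case: u => [[h1 h2] c] /=; rewrite !mulg1 !mulVg !mul1g. Qed.

Lemma compositum_lawV u : u \in compositum_carrier ->
  compositum_law (compositum_law_inv u) u = (1, 1, 1).
Proof.
case: u => [[h1 h2] c] _ /=.
by rewrite !mulgA !mulVg !mul1g !mulgVK !mulVg.
Qed.

End CompositumLaw.

(* The type depends on D so that each compositum-type law gives its own group
   structure. *)
Record compositum_group (gT : finGroupType) (G N : {group gT})
    (D : compositum_data G N) : predArgType := CompositumElt {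
  compositum_val : gT * gT * coset_of N;
  compositum_valP : compositum_val \in compositum_carrier G N
}.

Section CompositumGroup.

Variables (gT : finGroupType) (G N : {group gT}) (D : compositum_data G N).

HB.instance Definition _ := [isSub for @compositum_val gT G N D].
#[hnf] HB.instance Definition _ := [Finite of compositum_group D by <:].

Definition compositum_mul (u v : compositum_group D) : compositum_group D :=
  CompositumElt D
    (compositum_law_in D (compositum_valP u) (compositum_valP v)).

Definition compositum_one : compositum_group D :=
  CompositumElt D (compositum_one_in G N).

Definition compositum_inv (u : compositum_group D) : compositum_group D :=
  CompositumElt D (compositum_inv_in D (compositum_valP u)).

Lemma compositum_mulA : associative compositum_mul.
Proof.
by move=> u v w; apply: val_inj; apply: compositum_lawA; apply: compositum_valP.
Qed.

Lemma compositum_mul1 : left_id compositum_one compositum_mul.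
Proof. by move=> u; apply: val_inj; apply: compositum_law1. Qed.

Lemma compositum_mulV :
  left_inverse compositum_one compositum_inv compositum_mul.
Proof.
by move=> u; apply: val_inj; apply: compositum_lawV; apply: compositum_valP.
Qed.

HB.instance Definition _ := Finite_isGroup.Build (compositum_group D)
  compositum_mulA compositum_mul1 compositum_mulV.

End CompositumGroup.

(* Main.v *)
Require Import Defs.
From HB Require Import structures.
From mathcomp Require Import all_boot all_order all_fingroup all_algebra.
From mathcomp Require Import all_solvable all_field.
From mathcomp Require Import ring.

Set Implicit Arguments.
Unset Strict Implicit.
Unset Printing Implicit Defensive.

Import GroupScope GRing.Theory.

(** Let [L] be the compositum of [E1] and [E2] and [U] its Galois group over the
    rationals. Restriction embeds [U] in the product of the Galois groups of [E1]
    and [E2], as the fibre product over the Galois group of [K]. Identify both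
    factors with [G = GL_2(F)]; the two restrictions to [K] become surjections
    from [G] onto one abelian group of order [n], with kernels normal of index [n]
    and abelian quotient, hence both equal to [H] by [abelian_quotient_unique].
    They therefore differ by an automorphism [theta] of [G / H], and [U] consists
    of the pairs [(g1, g2)] such that [theta] maps the coset of [g2] to the coset
    of [g1].

    The coprimality of [n] and [(q - 1) / n] makes [H] complemented in [G]
    ([coprime_index_complement]): the elements of order dividing [n] in the cyclic
    group [T] of the matrices [diag(a, 1)] form a complement. Let [x_i] run
    through the complement, and let [y_i] be the element of the complement whose
    coset is mapped by [theta] to that of [x_i]. Each pair in [U] is then uniquely
    [(x_i h1, y_i h2)] with [h1] and [h2] in [H], and multiplying such pairs is
    the compositum-type law ([isog_compositum_group]).

    The facts on [G] rest on [GL2_der1_dilation]: [G] is the product of its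
    derived subgroup and [T]. Every transvection is a commutator as soon as the
    field has more than two elements, and transvections reduce any invertible
    matrix to [diag(a, 1)]. On the Galois side, [exists_compositum] builds [L],
    [restriction_onto] describes the restriction maps, and [Gal_meet_join] shows
    that the kernel of the restriction to [K], which is the intersection of [E1]
    and [E2], is generated by the kernels of the other two. *)

(** * The derived subgroup of GL_2 of a finite field *)

(** The equation determines [z] as [[~ x, y]]; stated without inverses, it can be
    checked by multiplying explicit matrices. *)
Lemma commg_eq_der1 (gT : finGroupType) (G : {group gT}) (x y z : gT) :
  x \in G -> y \in G -> (y * x * z = x * y)%g -> z \in (G^`(1))%g.
Proof.
move=> Gx Gy e; have -> : z = [~ x, y]%g.
  by apply: (mulgI (y * x)%g); rewrite -commgC e.
by rewrite derg1 mem_commg.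
Qed.

Section GL2.

Variable F : finFieldType.

Local Open Scope ring_scope.

(* Products of elements typed by the group structure, not by the matrix type,
   unify with lemmas on abstract groups without unfolding that structure. *)
Local Notation GL2 := ({'GL_2[F]} : finGroupType).

Definition mat2 (a b c d : F) : 'M[F]_2 :=
  \matrix_(i, j) if i == 0 then if j == 0 then a else b
                 else if j == 0 then c else d.

Lemma mat2_eta (A : 'M[F]_2) : A = mat2 (A 0 0) (A 0 1) (A 1 0) (A 1 1).
Proof.
apply/matrixP=> i j; rewrite mxE.
by case: i j => [[|[|//]] ?] [[|[|//]] ?]; congr (A _ _); apply: val_inj.
Qed.

Lemma mat2_congr a b c d a' b' c' d' : a = a' -> b = b' -> c = c' -> d = d' ->
  mat2 a b c d = mat2 a' b' c' d'.
Proof. by move=> -> -> -> ->. Qed.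

Lemma mat2M a b c d a' b' c' d' :
  mat2 a b c d *m mat2 a' b' c' d' =
  mat2 (a * a' + b * c') (a * b' + b * d') (c * a' + d * c') (c * b' + d * d').
Proof.
apply/matrixP=> i j; rewrite !mxE !big_ord_recl big_ord0 !mxE /= addr0.
by case: (i == 0); case: (j == 0).
Qed.

Lemma det_mat2 a b c d : \det (mat2 a b c d) = a * d - b * c.
Proof.
rewrite (expand_det_row _ 0) !big_ord_recl big_ord0 /cofactor !det_mx11 !mxE /=.
by rewrite /bump /=; ring.
Qed.

(** Total in the entries: a singular matrix gives the identity. *)
Definition gl2 a b c d : GL2 := insubd (1%g : {'GL_2[F]}) (mat2 a b c d).

Lemma gl2E a b c d : a * d - b * c != 0 -> GLval (gl2 a b c d) = mat2 a b c d.
Proof.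
move=> nz; apply: insubdK; rewrite -topredE /=.
by rewrite -[_ \is a _]/(mat2 a b c d \in unitmx) unitmxE det_mat2 unitfE.
Qed.

Definition upper t : GL2 := gl2 1 t 0 1.
Definition lower t : GL2 := gl2 1 0 t 1.
Definition dilation (a : {unit F}) : GL2 := gl2 (val a) 0 0 1.

Lemma upperE t : GLval (upper t) = mat2 1 t 0 1.
Proof. by rewrite gl2E // mulr0 mulr1 subr0 oner_neq0. Qed.

Lemma lowerE t : GLval (lower t) = mat2 1 0 t 1.
Proof. by rewrite gl2E // mul0r mulr1 subr0 oner_neq0. Qed.

Lemma dilationE a : GLval (dilation a) = mat2 (val a) 0 0 1.
Proof. by rewrite gl2E // mulr0 mulr1 subr0 -unitfE (valP a). Qed.

Lemma GL2_eq (x y : GL2) : GLval x = GLval y -> x = y.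
Proof. exact: val_inj. Qed.

Lemma GL2_ME (x y : GL2) : GLval (x * y)%g = GLval x *m GLval y.
Proof. by []. Qed.

Lemma det_GL_neq0 (x : GL2) : \det (GLval x : 'M[F]_2) != 0.
Proof. by rewrite -unitfE -unitmxE; exact: (GL_unitmx x). Qed.

Lemma dilationM : {in [set: {unit F}] &, {morph dilation : a b / (a * b)%g}}.
Proof.
move=> a b _ _; apply: GL2_eq; rewrite GL2_ME !dilationE mat2M.
by apply: mat2_congr; rewrite /=; ring.
Qed.

Canonical dilation_morphism := Morphism dilationM.

Lemma injm_dilation : 'injm dilation.
Proof.
apply/injmP=> a b _ _ /(congr1 GLval); rewrite !dilationE => /matrixP/(_ 0 0).
by rewrite !mxE => /val_inj.
Qed.

Definition dilation_group := (dilation @* [set: {unit F}])%G.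

Lemma cyclic_dilation : cyclic dilation_group.
Proof. exact/morphim_cyclic/field_unit_group_cyclic. Qed.

Lemma card_dilation : #|dilation_group| = #|F|.-1.
Proof. by rewrite card_injm ?injm_dilation // card_finField_unit. Qed.

(** Gaussian elimination: when the lower left entry [c] is nonzero, three
    transvections and a dilation by the determinant suffice; multiplying by
    [lower 1] makes that entry nonzero otherwise. *)
Lemma mul_dilation_GL2 (D : {group GL2}) :
    (forall t, upper t \in D) -> (forall t, lower t \in D) ->
  (D * dilation_group = 'GL_2[F])%g.
Proof.
move=> D_upper D_lower.
have gen_nz (g : GL2) : GLval g 1 0 != 0 -> g \in (D * dilation_group)%g.
- set a := GLval g 0 0; set b := GLval g 0 1; set c := GLval g 1 0.
  set d := GLval g 1 1 => nz_c.
  have gE : GLval g = mat2 a b c d := mat2_eta (GLval g).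
  have nz_det : a * d - b * c != 0 by rewrite -det_mat2 -gE det_GL_neq0.
  pose e : {unit F} := insubd (1%g : {unit F}) (a * d - b * c).
  have eE : val e = a * d - b * c by apply: insubdK; rewrite -topredE /= unitfE.
  have nz_e : val e != 0 by rewrite eE.
  pose x := (a - val e) / c; pose y := c / val e; pose z := (d - 1) * val e / c.
  (* Solve upper x * lower y * upper z * dilation e = g: the lower row gives y
     and z, and then the first column gives x. *)
  apply/mulsgP; exists (upper x * lower y * upper z)%g (dilation e).
  - exact: groupM (groupM (D_upper x) (D_lower y)) (D_upper z).
  - by rewrite mem_morphim ?inE.
  apply: GL2_eq; rewrite !GL2_ME dilationE !upperE !lowerE !mat2M gE.
  by apply: mat2_congr; rewrite /x /y /z eE; field; rewrite -?eE ?nz_e ?nz_c.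
apply/setP=> g; rewrite in_setT.
have [g10|] := eqVneq (GLval g 1 0) 0; last exact: gen_nz.
have gE := mat2_eta (GLval g); rewrite g10 in gE.
have: (lower 1%R * g)%g \in (D * dilation_group)%g.
  apply: gen_nz; rewrite GL2_ME lowerE gE mat2M mxE /= mul1r mulr0 addr0.
  apply: contraNneq (det_GL_neq0 g) => g00.
  by rewrite gE det_mat2 g00 mul0r mulr0 subr0.
case/mulsgP=> x y Dx Ty eg; rewrite -[g](mulKg (lower 1%R)) eg mulgA.
exact: mem_mulg (groupM (groupVr (D_lower 1)) Dx) Ty.
Qed.

Lemma GL2_commg_der1 (x y z : GL2) :
  GLval y *m GLval x *m GLval z = GLval x *m GLval y -> z \in ('GL_2[F]^`(1))%g.
Proof.
rewrite -!GL2_ME => /GL2_eq; exact: commg_eq_der1 (in_setT x) (in_setT y).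
Qed.

Section Generation.

Hypothesis F_gt2 : (2 < #|F|)%N.

Lemma exists_nontrivial_unit : exists a : {unit F}, val a - 1 != 0.
Proof.
have: (1 < #|[set: {unit F}]|)%N.
  by rewrite card_finField_unit -ltnS prednK // (ltn_trans _ F_gt2).
rewrite (cardD1 1%g) inE ltnS => /card_gt0P[a /andP[nt_a _]]; exists a.
by rewrite subr_eq0; apply: contraNneq nt_a => a1; apply/eqP/val_inj.
Qed.

(** Conjugating a transvection by [dilation a] rescales its parameter by [a] or
    its inverse; as [a - 1] is invertible, the commutators with [dilation a]
    give every transvection. *)
Lemma upper_der1 t : upper t \in ('GL_2[F]^`(1))%g.
Proof.
have [a nz_a] := exists_nontrivial_unit.
apply: (@GL2_commg_der1 (upper (- (val a * t) / (val a - 1))) (dilation a)).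
rewrite dilationE !upperE !mat2M.
by apply: mat2_congr; first [by ring | by field].
Qed.

Lemma lower_der1 t : lower t \in ('GL_2[F]^`(1))%g.
Proof.
have [a nz_a] := exists_nontrivial_unit.
apply: (@GL2_commg_der1 (lower (t / (val a - 1))) (dilation a)).
rewrite dilationE !lowerE !mat2M.
by apply: mat2_congr; first [by ring | by field].
Qed.

Lemma GL2_der1_dilation : ('GL_2[F]^`(1) * dilation_group = 'GL_2[F])%g.
Proof. exact: mul_dilation_GL2 upper_der1 lower_der1. Qed.

End Generation.

End GL2.

(** * Groups in which a cyclic subgroup supplements the derived subgroup *)

Section CyclicSupplement.

Variables (gT : finGroupType) (G T : {group gT}).
Hypotheses (cycT : cyclic T) (sTG : T \subset G) (GT : G^`(1) * T = G).

Lemma der1_sub_normal (N : {group gT}) :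
  N <| G -> abelian (G / N) -> G^`(1) \subset N.
Proof. by move=> /normal_norm; apply: der1_min. Qed.

Lemma mul_supplement (N : {group gT}) :
  N <| G -> abelian (G / N) -> N * T = G.
Proof.
move=> nNG abGN; apply/eqP; rewrite eqEsubset mul_subG ?(normal_sub nNG) //=.
by apply: subset_trans (mulSg T (der1_sub_normal nNG abGN)); rewrite GT.
Qed.

Lemma card_supplement_cap (N : {group gT}) :
  N <| G -> abelian (G / N) -> (#|G : N| * #|N :&: T| = #|T|)%N.
Proof.
move=> nNG abGN; apply/eqP; rewrite -(eqn_pmul2l (cardG_gt0 N)) mulnA.
rewrite Lagrange ?normal_sub //.
by rewrite mul_cardG mul_supplement.
Qed.

(** A normal subgroup [N] with abelian quotient contains the derived subgroup, so
    by Dedekind's law it is recovered from [N :&: T], and a cyclic group has at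
    most one subgroup of each order. *)
Lemma abelian_quotient_unique (M N : {group gT}) :
    M <| G -> abelian (G / M) -> N <| G -> abelian (G / N) ->
  #|G : M| = #|G : N| -> M :=: N.
Proof.
move=> nMG abGM nNG abGN iMN.
have recover (P : {group gT}) : P <| G -> abelian (G / P) ->
    P :=: G^`(1) * (T :&: P).
- move=> nPG abGP; rewrite group_modl ?der1_sub_normal // GT.
  exact/esym/setIidPr/normal_sub.
rewrite [LHS]recover // [RHS]recover //; congr (_ * _).
apply/eqP; rewrite (eq_subG_cyclic cycT) ?subsetIl //.
rewrite -(eqn_pmul2l (indexg_gt0 G M)) {2}iMN.
by rewrite /= !(setIC T) !card_supplement_cap.
Qed.

(** With [n] the index, [N :&: T] has order [#|T| %/ n], so it meets the subgroup
    of order [n] of [T] trivially, and that subgroup is a complement. *)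
Lemma coprime_index_complement (N : {group gT}) :
    N <| G -> abelian (G / N) -> coprime #|G : N| (#|T| %/ #|G : N|) ->
  exists C : {group gT}, C \in [complements to N in G].
Proof.
move=> nNG abGN co_n; set n := #|G : N| in co_n *.
have cardNT := card_supplement_cap nNG abGN.
have n_gt0 : (0 < n)%N := indexg_gt0 G N.
have dv_nT : (n %| #|T|)%N by rewrite -cardNT dvdn_mulr.
have [t Tt] := cyclicP cycT; exists <[t ^+ (#|T| %/ n)]>%G.
have cardC : #|<[t ^+ (#|T| %/ n)]>| = n.
  have ot : #[t] = #|T| by rewrite orderE -Tt.
  have dv_mT : (#|T| %/ n %| #[t])%N by rewrite ot -{2}(divnK dv_nT) dvdn_mulr.
  rewrite -orderE orderXdiv // ot -{1}(divnK dv_nT) mulKn //.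
  by rewrite divn_gt0 // dvdn_leq.
have sCT : <[t ^+ (#|T| %/ n)]> \subset T.
  by rewrite [X in _ \subset pred_of_set X]Tt cycleX.
have tiNC : N :&: <[t ^+ (#|T| %/ n)]> = 1.
  rewrite -(setIidPr sCT) setIA; apply: coprime_TIg.
  by rewrite cardC coprime_sym -(mulKn #|N :&: T| n_gt0) cardNT.
apply/complP; split=> //=; apply/eqP.
rewrite eqEcard mul_subG ?(normal_sub nNG) ?(subset_trans sCT) //=.
by rewrite TI_cardMg // cardC Lagrange ?normal_sub.
Qed.

End CyclicSupplement.

(** * Compositum-type laws and fibre products *)

(** By the first isomorphism theorem, both images are the quotient of [U] by the
    common kernel. *)
Lemma aut_of_common_kernel (aT rT : finGroupType) (U : {group aT})
    (Q : {group rT}) (f g : {morphism U >-> rT}) :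
    f @* U = Q -> g @* U = Q -> 'ker f = 'ker g ->
  exists2 t : {perm rT}, t \in Aut Q & {in U, forall u, t (f u) = g u}.
Proof.
move=> fU gU kfg; have sK : 'ker f \subset 'ker g by rewrite kfg.
have inj : 'injm (factm sK (subxx U)).
  by apply/injm_factmP; rewrite kfg.
have im : factm sK (subxx U) @* (f @* U) = f @* U.
  by rewrite morphim_factm fU gU.
exists (aut inj im); first by rewrite -fU; apply: Aut_aut.
by move=> u Uu; rewrite autE ?mem_morphim //= factmE.
Qed.

Section Complement.

Variables (gT : finGroupType) (G N C : {group gT}).
Hypotheses (nNG : N <| G) (compl : C \in [complements to N in G]).

(** The lift is the inverse of the isomorphism of the complement [C] with
    [G / N]. *)
Lemma complement_lift : exists rho : coset_of N -> gT,
  [/\ {in G / N, forall c, rho c \in G},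
      {in G / N, forall c, coset N (rho c) = c}
    & {in G / N &, {morph rho : c d / c * d}}].
Proof.
have [tiNC defG] := complP compl.
have sCG : C \subset G by rewrite -defG mulG_subr.
have nNC : C \subset 'N(N) := subset_trans sCG (normal_norm nNG).
have inj : 'injm (restrm nNC (coset N)).
  by rewrite ker_restrm ker_coset setIC tiNC.
have im : restrm nNC (coset N) @* C = G / N.
  by rewrite morphim_restrm setIid -defG quotientMidl.
exists (invm inj); rewrite -im; split=> [c Cc | c Cc | ].
- rewrite (subsetP sCG) // -[X in _ \in pred_of_set X](im_invm inj).
  by rewrite mem_morphim.
- exact: (invmK inj).
exact: (morphM (invm_morphism inj)).
Qed.

Let eN : #|G : N| = #|G / N| := esym (card_quotient (normal_norm nNG)).

Definition nth_coset (i : 'I_#|G : N|) : coset_of N :=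
  enum_val (cast_ord eN i).

Lemma nth_coset_mem i : nth_coset i \in G / N.
Proof. exact: enum_valP. Qed.

Lemma nth_coset_surj c : c \in G / N -> exists i, nth_coset i = c.
Proof.
move=> Gc; exists (cast_ord (esym eN) (enum_rank_in Gc c)).
by rewrite /nth_coset cast_ordKV enum_rankK_in.
Qed.

Lemma nth_coset_inj : injective nth_coset.
Proof. by move=> i j /enum_val_inj/cast_ord_inj. Qed.

(** Both systems of representatives run through one complement: [x] lists the
    lifts of the cosets in a fixed order, and [y] lists the lifts of their images
    under the inverse of [t], which is what the relation between [x] and [y]
    demands. *)
Lemma compositum_data_of_aut (t : {perm coset_of N}) :
  t \in Aut (G / N) -> exists D : compositum_data G N, cd_theta D = t.
Proof.
move=> At; have [rho [Grho rhoK rhoM]] := complement_lift.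
have Aut_mem (s : {perm coset_of N}) (As : s \in Aut (G / N)) c :
    c \in G / N -> s c \in G / N.
  move=> Gc; rewrite -(autmE As) -[X in _ \in pred_of_set X](im_autm As).
  by rewrite mem_morphim.
have Aut_mul (s : {perm coset_of N}) (As : s \in Aut (G / N)) :
    {in G / N &, {morph s : c d / c * d}}.
  by move=> c d Gc Gd; rewrite -(autmE As) morphM.
have repr_of (s : {perm coset_of N}) : s \in Aut (G / N) ->
    coset_representatives (fun i => rho (s (nth_coset i))) /\
    closed_under_mul (fun i => rho (s (nth_coset i))).
  move=> As; have sG i : s (nth_coset i) \in G / N.
    by rewrite Aut_mem ?nth_coset_mem.
  split; first split=> [i | c Gc]; first exact: Grho.
    have [i ci] := nth_coset_surj (Aut_mem _ (groupVr As) _ Gc).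
    exists i; split=> [|j cj]; first by rewrite rhoK // ci permKV.
    by apply: nth_coset_inj; rewrite ci -cj rhoK // permK.
  move=> i j.
  have [k ck] := nth_coset_surj (groupM (nth_coset_mem i) (nth_coset_mem j)).
  by exists k; rewrite ck Aut_mul ?nth_coset_mem // rhoM.
have [x_repr x_mul] := repr_of 1 (group1 _).
have [y_repr y_mul] := repr_of t^-1 (groupVr At).
have xy i : coset N (rho ((1 : {perm coset_of N}) (nth_coset i)))
            = t (coset N (rho (t^-1 (nth_coset i)))).
  by rewrite perm1 !rhoK ?permKV ?Aut_mem ?groupV ?nth_coset_mem.
by exists (CompositumData nNG At x_repr y_repr x_mul y_mul xy).
Qed.

End Complement.

(** The pair [(f1, f2)] embeds [U] in the fibre product of two surjections from
    [G] to [U / (f1 @*^-1 N)], both with kernel [N]; the order of [U] assumed in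
    the lemmas below is that of the whole fibre product. *)
Section FibreProduct.

Variables (aT gT : finGroupType) (U : {group aT}) (G N C : {group gT}).
Variables f1 f2 : {morphism U >-> gT}.
Hypotheses (nNG : N <| G) (compl : C \in [complements to N in G]).
Hypotheses (f1U : f1 @* U = G) (f2U : f2 @* U = G).
Hypotheses (tiK : 'ker f1 :&: 'ker f2 = 1) (f12N : f1 @*^-1 N = f2 @*^-1 N).

Section Law.

Variable D : compositum_data G N.
Hypothesis thetaE :
  {in U, forall u, cd_theta D (coset N (f2 u)) = coset N (f1 u)}.

Let idx u := cd_index D (coset N (f1 u)).

(* The unique factorisation f1 u = x_i h1, f2 u = y_i h2 with h1 and h2 in N; the
   index i is the same in both because theta maps the coset of f2 u to that of
   f1 u. *)
Let to_triple u : gT * gT * coset_of N :=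
  ((cd_x D (idx u))^-1 * f1 u, (cd_y D (idx u))^-1 * f2 u, coset N (f1 u)).

Let f1G u : u \in U -> f1 u \in G.
Proof. by rewrite -f1U => Uu; apply: mem_morphim. Qed.

Let f2G u : u \in U -> f2 u \in G.
Proof. by rewrite -f2U => Uu; apply: mem_morphim. Qed.

Let f1GN u : u \in U -> coset N (f1 u) \in G / N.
Proof. by move=> Uu; rewrite mem_quotient ?f1G. Qed.

Let nN x : x \in G -> x \in 'N(N).
Proof. exact/subsetP/normal_norm. Qed.

Let coset_diff a b :
  a \in 'N(N) -> b \in 'N(N) -> coset N a = coset N b -> a^-1 * b \in N.
Proof.
move=> Na Nb eab; apply: coset_idr; first by rewrite groupM ?groupV.
by rewrite morphM ?groupV // morphV //= eab mulVg.
Qed.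

Let to_triple_mem u : u \in U -> to_triple u \in compositum_carrier G N.
Proof.
move=> Uu; rewrite !inE /= f1GN // andbT; apply/andP; split.
  by apply: coset_diff; rewrite ?cd_x_nN ?nN ?f1G // cd_indexK ?f1GN.
apply: coset_diff; rewrite ?cd_y_nN ?nN ?f2G //.
by apply: (@perm_inj _ (cd_theta D)); rewrite cd_index_theta ?thetaE ?f1GN.
Qed.

(* The default value 1 is taken only outside of U. *)
Let to_compositum u : compositum_group D :=
  insubd (1 : compositum_group D) (to_triple u).

Let to_compositumE u : u \in U -> val (to_compositum u) = to_triple u.
Proof. by move=> Uu; rewrite insubdK ?to_triple_mem. Qed.

(* Multiplicativity is the origin of the law:
   (x_i h1) (x_j k1) = x_i x_j (x_j^-1 h1 x_j k1). *)
Let to_compositumM : {in U &, {morph to_compositum : u v / u * v}}.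
Proof.
move=> u v Uu Uv; apply: val_inj; rewrite to_compositumE ?groupM //.
rewrite -[RHS]/(compositum_law D (val _) (val _)) !to_compositumE //=.
rewrite /to_triple /idx !morphM ?nN ?f1G //=.
rewrite (cd_xM D (f1GN Uu) (f1GN Uv)) (cd_yM D (f1GN Uu) (f1GN Uv)).
have regroup (x y a b : gT) :
  (x * y)^-1 * (a * b) = y^-1 * (x^-1 * a) * y * (y^-1 * b).
- by rewrite invMg !mulgA mulgK.
by rewrite !regroup.
Qed.

(** The map [u |-> to_triple u] is injective because the kernels of [f1] and [f2]
    meet trivially, hence bijective by comparison of orders. *)
Lemma isog_compositum_group :
  #|U| = (#|N| * #|N| * #|G : N|)%N -> U \isog [set: compositum_group D].
Proof.
move=> cardU; pose h := Morphism to_compositumM.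
have injh : 'injm h.
  apply/subsetP=> u /morphpreP[Uu /set1P/(congr1 val)]; rewrite /h /=.
  rewrite to_compositumE //.
  case; rewrite /idx => e1 e2 e3; rewrite -tiK inE.
  move: e1 e2; rewrite /to_triple /idx e3 cd_x1 cd_y1 invg1 !mul1g => e1 e2.
  by apply/andP; split; apply/kerP.
apply/isogP; exists h => //; apply/eqP; rewrite eqEcard subsetT card_injm //=.
rewrite cardU cardsT card_sub /= -card_quotient ?normal_norm //.
by rewrite /compositum_carrier !cardsX.
Qed.

End Law.

Lemma exists_compositum_law :
    #|U| = (#|N| * #|N| * #|G : N|)%N ->
  exists D : compositum_data G N, U \isog [set: compositum_group D].
Proof.
move=> cardU.
have sU (f : {morphism U >-> gT}) : f @* U = G -> U \subset f @*^-1 'N(N).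
  by move=> fU; rewrite -sub_morphim_pre // fU normal_norm.
have im (f : {morphism U >-> gT}) (fU : f @* U = G) :
    restrm (sU f fU) (coset N \o f) @* U = G / N.
  by rewrite morphim_restrm setIid morphim_comp fU.
have ker_ (f : {morphism U >-> gT}) (fU : f @* U = G) :
    'ker (restrm (sU f fU) (coset N \o f)) = f @*^-1 N.
  rewrite ker_restrm ker_comp ker_coset; apply/setIidPr.
  exact: subsetIl.
have [t At tE] := aut_of_common_kernel (im f2 f2U) (im f1 f1U)
  (etrans (ker_ f2 f2U) (etrans (esym f12N) (esym (ker_ f1 f1U)))).
have [D Dt] := compositum_data_of_aut nNG compl At.
by exists D; apply: isog_compositum_group => // u Uu; rewrite Dt; apply: tE.
Qed.

End FibreProduct.

(** * Restriction of automorphisms along an embedding of normal extensions *)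

Section Restriction.

Variables (F : fieldType) (E L : splittingFieldType F) (j : 'AHom(E, L)).

Local Open Scope ring_scope.

Let j_inj : injective j := fmorph_inj j.

Let G := 'Gal({:L} / 1%AS)%g.

Lemma map_poly_ahom_alg (p : {poly F}) :
  map_poly j (map_poly (in_alg E) p) = map_poly (in_alg L) p.
Proof.
by rewrite -map_poly_comp; apply: eq_map_poly => a; apply: rmorph_alg.
Qed.

(** The image of [E] is normal: [s] maps [j a] to a root of the minimal polynomial
    of [a] over the base field, and all those roots come from [E]. *)
Lemma gal_stable_image (s : gal_of {:L}) a : s (j a) \in (j @: {:E})%VS.
Proof.
have /polyOver1P[p minp] := minPolyOver 1%AS a.
have [r /eqP def_r] := splitting_field_normal 1%AS a.
have s1 : kHom 1%AS {:L} s by apply: k1AHom.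
have : root (map_poly j (minPoly 1%AS a)) (s (j a)).
  apply: (kHom_root_id (sub1v _) s1); rewrite ?memvf //.
    by rewrite minp map_poly_ahom_alg; apply/polyOver1P; exists p.
  by rewrite fmorph_root root_minPoly.
rewrite def_r rmorph_prod /=.
rewrite (eq_bigr (fun y => 'X - (j y)%:P)) => [|y _]; last first.
  by rewrite map_polyXsubC.
rewrite -(big_map j xpredT (fun z => 'X - z%:P)) root_prod_XsubC.
by case/mapP=> y _ ->; rewrite memv_img ?memvf.
Qed.

Lemma gal_restriction (s : gal_of {:L}) :
  {t : gal_of {:E} | t \in 'Gal({:E} / 1%AS)%g & forall a, j (t a) = s (j a)}.
Proof.
pose f : 'End(E) := (j^-1 \o (s \o j))%VF.
have jf a : j (f a) = s (j a).
  by rewrite !lfunE /= lfunE /= limg_lfunVK ?gal_stable_image.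
have homf : kHom 1%AS {:E} f.
  apply/kHomP_tmp.
  split=> [_ /vlineP[c ->] | a b _ _]; apply: j_inj; rewrite jf.
    by rewrite !rmorph_alg.
  by rewrite !rmorphM /= !jf.
have autf : kAut 1%AS {:E} f by rewrite kAutfE.
have [t Gt ft] := kAut_to_gal autf; exists t => // a.
by rewrite -ft ?memvf.
Qed.

Lemma restriction_morphism :
  exists f : {morphism G >-> gal_of {:E}},
    f @* G \subset 'Gal({:E} / 1%AS)%g /\ 'ker f = 'Gal({:L} / j @: {:E})%g.
Proof.
pose f (s : gal_of {:L}) := s2val (gal_restriction s).
have fE s a : j (f s a) = s (j a) := s2valP' (gal_restriction s) a.
have fM : {in G &, {morph f : s t / (s * t)%g}}.
  move=> s t _ _; apply/eqP/gal_eqP => a _; apply: j_inj.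
  by rewrite galM ?memvf // !fE galM ?memvf.
exists (Morphism fM); split.
  by apply/subsetP=> _ /morphimP[s _ _ ->]; apply: (s2valP (gal_restriction s)).
apply/setP=> s; apply/idP/idP=> [ker_s | fix_s].
  have fs1 : f s = 1%g := mker ker_s.
  rewrite (gal_kHom _ (subvf _)); apply/kAHomP=> _ /memv_imgP[a _ ->].
  by rewrite -fE fs1 gal_id.
have Gs : s \in G := subsetP (galS _ (sub1v _)) s fix_s.
apply/kerP=> //; apply/eqP/gal_eqP=> a _; apply: j_inj.
by rewrite gal_id fE (fixed_gal (subvf _) fix_s) ?memv_img ?memvf.
Qed.

(** Surjectivity follows from the degree formula: the image has order the
    degree of [L] divided by its degree over the image of [E]. *)
Lemma restriction_onto :
    galois 1%AS {:E}%AS -> galois 1%AS {:L}%AS ->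
  exists f : {morphism G >-> gal_of {:E}},
    f @* G = 'Gal({:E} / 1%AS)%g /\ 'ker f = 'Gal({:L} / j @: {:E})%g.
Proof.
move=> galE galL; have [f [im_f ker_f]] := restriction_morphism.
exists f; split=> //; apply/eqP; rewrite eqEcard im_f /=.
have galLE : galois (j @: {:E})%AS {:L}%AS.
  by apply: galoisS galL; rewrite sub1v subvf.
rewrite card_morphim setIid ker_f -divgS ?galS ?sub1v //.
rewrite -(galois_dim galE) -(galois_dim galL) -(galois_dim galLE).
have <- : \dim (j @: {:E}) = \dim {:E}.
  have /lker0P/eqP ker_j : injective j := j_inj.
  by apply: limg_dim_eq; rewrite ker_j capv0.
have dv_jE : (\dim (j @: {:E}) %| \dim {:L})%N.
  exact: field_dimS (subvf (j @: {:E})%AS).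
rewrite !dimv1 !divn1 -[X in (_ <= X %/ _)%N](divnK dv_jE) mulKn //.
rewrite divn_gt0 ?adim_gt0 //.
exact: dvdn_leq (adim_gt0 _) dv_jE.
Qed.

End Restriction.

Lemma galois_char0 (F : fieldType) (L : splittingFieldType F) :
  [pchar F]%R =i pred0 -> galois 1%AS {:L}%AS.
Proof.
move=> F0; rewrite /galois sub1v normalFieldf andbT /=.
apply/separableP=> x _; apply: pcharf0_separable.
by move=> p; rewrite pchar_lalg F0.
Qed.

(** By the Galois correspondence, as the fixed field of the join is contained in
    both [A] and [B]. *)
Lemma Gal_meet_join (F : fieldType) (L : splittingFieldType F)
    (A B M : {subfield L}) :
    galois 1%AS {:L}%AS -> (forall x, x \in A -> x \in B -> x \in M) ->
    (M <= A)%VS -> (M <= B)%VS ->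
  ('Gal({:L} / M) = 'Gal({:L} / A) <*> 'Gal({:L} / B))%g.
Proof.
move=> galL capAB sMA sMB; apply/eqP.
rewrite eqEsubset join_subG !galS // andbT.
have <- := gal_fixedField ('Gal({:L} / A) <*> 'Gal({:L} / B))%G.
rewrite andbT; apply: galS; apply/subvP=> x xfix.
have fixS (K : {subfield L}) :
    ('Gal({:L} / K) \subset 'Gal({:L} / A) <*> 'Gal({:L} / B))%g -> x \in K.
  move=> /fixedFieldS/subvP/(_ x xfix).
  have galLK : galois K {:L}%AS by apply: galoisS galL; rewrite sub1v subvf.
  by rewrite (galois_fixedField galLK).
by apply: capAB; apply: fixS; rewrite ?joing_subl ?joing_subr.
Qed.

(** * The compositum of two number fields *)

Section NumberFields.

Local Open Scope ring_scope.

Lemma lift_embedding (E L : fieldExtType rat)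
    (h : {rmorphism L -> algC}) (i : {rmorphism E -> algC}) :
    (forall a, exists b, h b = i a) ->
  exists j : 'AHom(E, L), forall a, h (j a) = i a.
Proof.
move=> im_i; pose j a := sval (sig_eqW (im_i a)).
have jE a : h (j a) = i a := svalP (sig_eqW (im_i a)).
have jB : zmod_morphism j.
  by move=> a b; apply: (fmorph_inj h); rewrite rmorphB !jE rmorphB.
have jM : monoid_morphism j.
  split=> [|a b]; apply: (fmorph_inj h); first by rewrite rmorph1 jE rmorph1.
  by rewrite rmorphM !jE rmorphM.
pose jb := GRing.isZmodMorphism.Build _ _ j jB.
pose jm := GRing.isMonoidMorphism.Build _ _ j jM.
pose jz := GRing.isScalable.Build _ _ _ _ j (rat_linear jB).
pose jLR : {lrmorphism E -> L} := HB.pack j jb jm jz.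
by exists (linfun_ahom jLR) => a; rewrite lfunE /= jE.
Qed.

Lemma embedding_image_basis (E L : fieldExtType rat)
    (h : {rmorphism L -> algC}) (i : {rmorphism E -> algC}) :
    {in vbasis {:E}, forall v, exists b, h b = i v} ->
  forall a, exists b, h b = i a.
Proof.
move=> im_i a; rewrite (coord_vbasis (memvf a)).
apply: (big_ind (fun x => exists b, h b = i x)) => [|x y [b bx] [c cy]|k _].
- by exists 0; rewrite !rmorph0.
- by exists (b + c); rewrite !rmorphD bx cy.
have [|b bE] := im_i (vbasis {:E})`_k; first by rewrite mem_nth ?size_tuple.
by exists (coord (vbasis {:E}) k a *: b); rewrite !rmorphZ_num bE.
Qed.

(** The field generated by the images of bases of [E1] and [E2] is normal: it is a
    splitting field of the product of two polynomials that [E1] and [E2] split.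
    The last clause says that it is generated by the images of [E1] and [E2]. *)
Lemma exists_compositum (E1 E2 : splittingFieldType rat)
    (i1 : {rmorphism E1 -> algC}) (i2 : {rmorphism E2 -> algC}) :
  exists (L : splittingFieldType rat) (h : {rmorphism L -> algC})
         (j1 : 'AHom(E1, L)) (j2 : 'AHom(E2, L)),
    [/\ forall a, h (j1 a) = i1 a, forall b, h (j2 b) = i2 b
      & forall U : {subfield L}, (j1 @: {:E1} <= U)%VS ->
          (j2 @: {:E2} <= U)%VS -> U = {:L}%AS].
Proof.
have [L0 [h [s hs gen_s]]] :=
  num_field_exists (map i1 (vbasis {:E1}) ++ map i2 (vbasis {:E2})).
have [|j1 j1E] := @lift_embedding E1 L0 h i1.
  apply: embedding_image_basis => v v_bas.
  have: i1 v \in map h s by rewrite hs mem_cat map_f.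
  by case/mapP=> b _ ->; exists b.
have [|j2 j2E] := @lift_embedding E2 L0 h i2.
  apply: embedding_image_basis => v v_bas.
  have: i2 v \in map h s by rewrite hs mem_cat orbC map_f.
  by case/mapP=> b _ ->; exists b.
have gen (U : {subfield L0}) :
    (j1 @: {:E1} <= U)%VS -> (j2 @: {:E2} <= U)%VS -> ({:L0} <= U)%VS.
  move=> /subvP sU1 /subvP sU2; rewrite -gen_s; apply/Fadjoin_seqP.
  split=> [|b bs]; first exact: sub1v.
  have: h b \in map h s by rewrite map_f.
  rewrite hs mem_cat => /orP[] /mapP[v _].
    by rewrite -j1E => /fmorph_inj->; rewrite sU1 ?memv_img ?memvf.
  by rewrite -j2E => /fmorph_inj->; rewrite sU2 ?memv_img ?memvf.
have [p1 F1p1 [r1 Dp1 gen1]] := @splittingFieldP _ E1.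
have [p2 F2p2 [r2 Dp2 gen2]] := @splittingFieldP _ E2.
have splitL : splitting_field_axiom L0.
  have over1 (E : splittingFieldType rat) (j : 'AHom(E, L0)) p :
      p \is a polyOver 1%VS -> map_poly j p \is a polyOver 1%VS.
    case/polyOver1P=> q ->; apply/polyOver1P; exists q.
    by rewrite -map_poly_comp; apply: eq_map_poly => a; apply: rmorph_alg.
  have split_map (E : splittingFieldType rat) (j : 'AHom(E, L0)) p r :
      p %= \prod_(z <- r) ('X - z%:P) ->
      map_poly j p %= \prod_(z <- map j r) ('X - z%:P).
    rewrite -(eqp_map j) rmorph_prod big_map /=.
    by under eq_bigr => z _ do rewrite map_polyXsubC.
  exists (map_poly j1 p1 * map_poly j2 p2); first by rewrite rpredM ?over1.
  exists (map j1 r1 ++ map j2 r2).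
    rewrite big_cat; apply: eqp_trans (eqp_mulr _ (split_map _ _ _ _ Dp1)) _.
    exact: eqp_mull (split_map _ _ _ _ Dp2).
  apply/eqP; rewrite eqEsubv subvf; apply: gen.
    rewrite -gen1 aimg_adjoin_seq aimg1; apply/Fadjoin_seqP.
    split=> [|b b_r]; first exact: sub1v.
    by rewrite seqv_sub_adjoin // mem_cat b_r.
  rewrite -gen2 aimg_adjoin_seq aimg1; apply/Fadjoin_seqP.
  split=> [|b b_r]; first exact: sub1v.
  by rewrite seqv_sub_adjoin // mem_cat b_r orbT.
pose splitM := FieldExt_isSplittingField.Build _ L0 splitL.
pose L : splittingFieldType rat := HB.pack L0 splitM.
exists L, h, j1, j2; split=> // U sU1 sU2.
by apply/val_inj/eqP; rewrite eqEsubv subvf gen.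
Qed.

End NumberFields.

(** * Realization over the rationals *)

(** As the kernels meet trivially, [f2] maps [f2 @*^-1 N] onto [N] with kernel
    ['ker f2] and complement ['ker f1], so [#|'ker f1| = #|N|]. *)
Lemma card_fibre_product (aT gT : finGroupType) (U : {group aT})
    (G N : {group gT}) (f1 f2 : {morphism U >-> gT}) :
    N \subset G -> f1 @* U = G -> f2 @* U = G -> 'ker f1 :&: 'ker f2 = 1 ->
    f1 @*^-1 N = 'ker f1 <*> 'ker f2 -> f2 @*^-1 N = 'ker f1 <*> 'ker f2 ->
  #|U| = (#|N| * #|N| * #|G : N|)%N.
Proof.
move=> sNG f1U f2U tiK f1N f2N.
have cardJ : #|'ker f1 <*> 'ker f2| = (#|'ker f1| * #|'ker f2|)%N.
  rewrite norm_joinEr ?TI_cardMg //.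
  exact: subset_trans (normal_sub (ker_normal f2)) (ker_norm f1).
have k1 : #|'ker f1| = #|N|.
  apply/eqP; rewrite -(eqn_pmul2l (cardG_gt0 ('ker f2)%G)) /=.
  by rewrite -card_morphpre ?f2U // f2N cardJ mulnC.
rewrite -mulnA [(#|N| * #|G : N|)%N]Lagrange // -{1}k1 -f1U -card_morphpre //.
by rewrite (morphimGK (normal_sub (ker_normal f1)) (subxx U)).
Qed.

(** The Galois group of the compositum of [E1] and [E2] restricts onto the Galois
    groups of [E1], [E2] and [K]; the first two restrictions have kernels that
    meet trivially and generate the kernel of the third. Uniqueness of [H] enters
    to make both images of the third kernel equal to [H], whichever isomorphisms
    with [G] were chosen. *)
Lemma realize_compositum_group (gT : finGroupType) (G H C : {group gT})
    (E1 E2 K : splittingFieldType rat)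
    (i1 : {rmorphism E1 -> algC}) (i2 : {rmorphism E2 -> algC})
    (k : {rmorphism K -> algC}) :
    has_galois_group E1 G -> has_galois_group E2 G ->
    image_is_intersection k i1 i2 -> abelian_extension K ->
    (forall M : {group gT}, M <| G -> abelian (G / M) ->
       #|G : M| = \dim {:K} -> M :=: H) ->
    H <| G -> C \in [complements to H in G] ->
  exists D : compositum_data G H,
    realizable_over_rat [set: compositum_group D].
Proof.
case=> galE1 isoE1 [galE2 isoE2] K_inter [galK abK] uniqH nHG compl.
have [L [h [j1 [j2 [j1E j2E gen]]]]] := exists_compositum i1 i2.
have galL : galois 1%AS {:L}%AS.
  by apply: galois_char0; apply: Num.Theory.pchar_num.
have [jk jkE] : exists jk : 'AHom(K, L), forall c, h (jk c) = k c.
  apply: lift_embedding => c.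
  have [[a <-] _] := (K_inter (k c)).1 (ex_intro _ c erefl).
  by exists (j1 a).
pose U := 'Gal({:L} / 1%AS)%G.
have onto (E : splittingFieldType rat) (j : 'AHom(E, L)) :
    galois 1%AS {:E}%AS -> 'Gal({:E} / 1%AS) \isog G ->
  exists f : {morphism U >-> gT}, f @* U = G /\ 'ker f = 'Gal({:L} / j @: {:E}).
- move=> galE /isogP[g inj_g im_g].
  have [f [im_f ker_f]] := restriction_onto j galE galL.
  have sU : U \subset f @*^-1 'Gal({:E} / 1%AS).
    by rewrite -sub_morphim_pre ?im_f.
  exists (restrm sU (g \o f)); split.
    by rewrite morphim_restrm setIid morphim_comp im_f.
  rewrite ker_restrm ker_comp (trivgP inj_g) -ker_f.
  exact/setIidPr/(normal_sub (ker_normal f)).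
have [f1 [im_f1 ker_f1]] := onto E1 j1 galE1 isoE1.
have [f2 [im_f2 ker_f2]] := onto E2 j2 galE2 isoE2.
have [fk [im_fk ker_fk]] := restriction_onto jk galK galL.
have kerJ : 'ker fk = 'ker f1 <*> 'ker f2.
  rewrite ker_fk ker_f1 ker_f2.
  have in_img (E : splittingFieldType rat) (j : 'AHom(E, L)) x a :
    h x = h (j a) -> x \in (j @: {:E})%VS.
  - by move=> /fmorph_inj->; rewrite memv_img ?memvf.
  apply: (@Gal_meet_join _ _ (j1 @: _)%AS (j2 @: _)%AS (jk @: {:K})%AS) => //.
  - move=> _ /memv_imgP[a _ ->] /memv_imgP[b _ eab].
    have [|c ck] := (K_inter (i1 a)).2.
      by split; [exists a | exists b; rewrite -j2E -eab j1E].
    by apply: (in_img _ _ _ c); rewrite jkE ck j1E.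
  - apply/subvP=> _ /memv_imgP[c _ ->].
    have [[a ea] _] := (K_inter (k c)).1 (ex_intro _ c erefl).
    by apply: (in_img _ _ _ a); rewrite jkE j1E.
  apply/subvP=> _ /memv_imgP[c _ ->].
  have [_ [b eb]] := (K_inter (k c)).1 (ex_intro _ c erefl).
  by apply: (in_img _ _ _ b); rewrite jkE j2E.
(* An automorphism in both kernels fixes j1 E1 and j2 E2, which generate L. *)
have tiK : 'ker f1 :&: 'ker f2 = 1.
  apply/trivgP/subsetP=> s /setIP[]; rewrite /= ker_f1 ker_f2 => fix1 fix2.
  have fixL : fixedField_aspace <[s]>%g = {:L}%AS.
    by apply: gen; rewrite /= -galois_connection ?subvf ?cycle_subG.
  apply/set1P/eqP/gal_eqP=> x _; rewrite gal_id.
  have: x \in fixedField_aspace <[s]>%g by rewrite fixL memvf.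
  by case/mem_fixedFieldP=> _; apply; apply: cycle_id.
(* The image under f of the kernel of fk is normal of index the degree of K, with
   abelian quotient. *)
have preH (f : {morphism U >-> gT}) :
  f @* U = G -> 'ker f \subset 'ker fk -> f @*^-1 H = 'ker fk.
- move=> im_f skf.
  have nKU : 'ker fk <| U by apply: ker_normal.
  rewrite -(uniqH (f @* 'ker fk)%G); first by rewrite
    morphimGK ?(normal_sub (ker_normal _)).
  - by rewrite -im_f morphim_normal.
  - have -> : G = (f @* U)%G by apply: val_inj.
    apply: sub_der1_abelian.
    rewrite /= -morphim_der ?morphimS // der1_min ?normal_norm //.
    by rewrite (isog_abelian (first_isog fk)) /= im_fk.
  rewrite -im_f -(@index_morphpre _ _ U f) ?subxx //.
  rewrite !morphimGK ?(normal_sub (ker_normal _)) //.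
  have := card_morphim fk U; rewrite setIid im_fk => <-.
  by rewrite -(galois_dim galK) dimv1 divn1.
have f1H : f1 @*^-1 H = 'ker f1 <*> 'ker f2.
  by rewrite -kerJ preH // kerJ joing_subl.
have f2H : f2 @*^-1 H = 'ker f1 <*> 'ker f2.
  by rewrite -kerJ preH // kerJ joing_subr.
have cardU := card_fibre_product (normal_sub nHG) im_f1 im_f2 tiK f1H f2H.
have [|D isoD] := exists_compositum_law nHG compl im_f1 im_f2 tiK _ cardU.
  by rewrite f1H f2H.
by exists D, L.
Qed.

Theorem theorem2p6 (n p r q : nat) (F : finFieldType)
    (n_gt0 : (0 < n)%N) (r_gt0 : (0 < r)%N)
    (p_prime : prime p) (p_odd : odd p)
    (q_def : q = (p ^ r)%N) (cardF : #|F| = q)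
    (q_mod_n : (q = 1 %[mod n])%N)
    (n_coprime : coprime n ((q - 1) %/ n)%N)
    (E1 E2 K : splittingFieldType rat)
    (i1 : {rmorphism E1 -> algC}) (i2 : {rmorphism E2 -> algC})
    (k : {rmorphism K -> algC})
    (galE1 : has_galois_group E1 'GL_2[F])
    (galE2 : has_galois_group E2 'GL_2[F])
    (K_inter : image_is_intersection k i1 i2)
    (K_abelian : abelian_extension K) (K_degree : \dim {:K} = n)
    (H : {group {'GL_2[F]}}) (H_normal : H <| 'GL_2[F])
    (H_index : #|'GL_2[F] : H| = n) (H_abelian : abelian ('GL_2[F] / H)) :
  exists D : compositum_data 'GL_2[F] H,
    realizable_over_rat [set: compositum_group D].
Proof.
have F_gt2 : (2 < #|F|)%N.
  rewrite cardF q_def; apply: leq_trans (odd_prime_gt2 p_odd p_prime) _.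
  by rewrite -{1}(expn1 p) leq_exp2l ?prime_gt1.
have cycT := cyclic_dilation F.
have sTG : dilation_group F \subset 'GL_2[F] by apply: subsetT.
have GT := GL2_der1_dilation F_gt2.
have [|C complC] := coprime_index_complement cycT sTG GT H_normal H_abelian.
  by rewrite H_index card_dilation cardF -subn1.
apply: (realize_compositum_group galE1 galE2 K_inter K_abelian _ H_normal) complC.
move=> M nMG abM iM.
apply: (abelian_quotient_unique cycT sTG GT nMG abM H_normal H_abelian).
by rewrite iM K_degree.
Qed.
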